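(* Let $\check u^{(1)}$ and $\check u^{(2)}$ be Geronimus transformations of the bivariate linear functional $u$ associated with the Laurent polynomials $L^{(1)}$ and $L^{(2)}$, where the Gram matrices $G,\check G^{(1)},\check G^{(2)}$ are quasidefinite. Let $$\Omega^{(1)}_1=S_1L^{(1)}(\Upsilon)(\check S^{(1)}_1)^{-1},\quad\Omega^{(1)}_2=\check S^{(1)}_2S_2^{-1},\quad\Omega^{(2)}_1=\check S^{(2)}_1S_1^{-1},\quad\Omega^{(2)}_2=S_2L^{(2)}(\Upsilon)(\check S^{(2)}_2)^{-1}.$$ Then, for every $z\in\mathbb C^*$ in the domains of definition of the Cauchy second kind functions involved in each identity, $$(C_2(z))^\dagger(\Omega^{(1)}_2)^\dagger-L^{(1)}(\bar z)(\check C^{(1)}_2(z))^\dagger=-\big\langle\delta L^{(1)}(\bar z,z_1),(\check\phi^{(1)}_2(z_2))^\top\big\rangle_{\check u^{(1)}},$$ $$\Omega^{(2)}_1C_1(z)-\check C^{(2)}_1(z)\,\overline{L^{(2)}}(z)=-\big\langle\check\phi^{(2)}_1(z_1),\delta L^{(2)}(\bar z,z_2)\big\rangle_{\check u^{(2)}},$$ $$\Omega^{(1)}_1\check C^{(1)}_1(z)=C_1(z),\qquad(\check C^{(2)}_2(z))^\dagger(\Omega^{(2)}_2)^\dagger=(C_2(z))^\dagger.$$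
   Context: Indices start at $0$; $\mathbb C^*=\mathbb C\setminus\{0\}$; a bar over a set is the set of complex conjugates; $\overline L(z):=\overline{L(\bar z)}$; $\delta L(x,y):=\frac{L(x)-L(y)}{x-y}$. CMV sequence: $\chi(z)=[1,z^{-1},z,z^{-2},z^2,\dots]^\top$. $\Upsilon$ is the semi-infinite permutation matrix with $\Upsilon\chi(z)=z\chi(z)$, i.e. its nonzero entries, all equal to $1$, are $\Upsilon_{2k,2k+2}$, $\Upsilon_{1,0}$, $\Upsilon_{2k+3,2k+1}$ ($k\ge0$); $\Upsilon^{-1}=\Upsilon^\top$; $L(\Upsilon)=\sum_jL_j\Upsilon^j$. A bivariate linear functional $v=v_{z_1,\bar z_2}$ is a continuous linear functional with well-defined closed support in $\mathbb C^*\times\mathbb C^*$ on a space of test functions (e.g. a compactly supported distribution) containing all $f(z_1)\otimes\overline{g(z_2)}:=f(z_1)\overline{g(z_2)}$ with $f,g$ Laurent polynomials or, more generally, rational functions with nonzero poles outside $\operatorname{supp}_1(v)$, resp. $\operatorname{supp}_2(v)$, the projections of the support on the $z_1$-, resp. $z_2$-coordinate; $\langle f,g\rangle_v=\langle v,f(z_1)\otimes\overline{g(z_2)}\rangle$, extended entrywise to column vectors in the first slot and row vectors in the second. The Gram matrix of $v$ has entries $\langle\chi^{(k)},\chi^{(l)}\rangle_v$; quasidefinite means that all leading principal minors are nonzero. Then $G=S_1^{-1}H(S_2^{-1})^\dagger$ (Gram matrix of $u$) uniquely, with $S_1,S_2$ lower unitriangular and $H$ diagonal with nonzero entries; $\phi_a=S_a\chi$.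 Cauchy second kind functions: $C_1(z)=\langle\phi_1(z_1),\frac1{\bar z-z_2}\rangle_u=\langle u,\phi_1(z_1)\otimes\frac1{z-\bar z_2}\rangle$ for $z\notin\overline{\operatorname{supp}_2(u)}$ (a column vector) and $(C_2(z))^\dagger=\langle\frac1{\bar z-z_1},(\phi_2(z_2))^\top\rangle_u$ for $z\notin\overline{\operatorname{supp}_1(u)}$ (a row vector). $L^{(a)}(z)=L^{(a)}_nz^n+\dots+L^{(a)}_{-m}z^{-m}$, $L^{(a)}_nL^{(a)}_{-m}\ne0$, $n,m\in\{0,1,\dots\}$, with zero sets $\sigma(L^{(a)})\subset\mathbb C^*$ such that $\sigma(L^{(1)})\cap\operatorname{supp}_1(u)=\varnothing$, $\sigma(L^{(2)})\cap\operatorname{supp}_2(u)=\varnothing$. Geronimus transformations are bivariate functionals with $L^{(1)}(z_1)\check u^{(1)}=u$ and $\check u^{(2)}\overline{L^{(2)}(z_2)}=u$, i.e. $\langle L^{(1)}f,g\rangle_{\check u^{(1)}}=\langle f,g\rangle_u$ and $\langle f,L^{(2)}g\rangle_{\check u^{(2)}}=\langle f,g\rangle_u$ for admissible test functions. Explicitly, with zeros $\zeta^{(a)}_i$ of multiplicity $m^{(a)}_i$ ($i=1,\dots,d^{(a)}$) and univariate linear functionals $\xi^{(a)}_{i,r}$, $0\le r<m^{(a)}_i$: $\langle f,g\rangle_{\check u^{(1)}}=\langle u,\frac f{L^{(1)}}\otimes\bar g\rangle+\sum_{i,r}\frac1{r!}f^{(r)}(\zeta^{(1)}_i)\overline{\langle\xi^{(1)}_{i,r},g\rangle}$,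 $\langle f,g\rangle_{\check u^{(2)}}=\langle u,f\otimes\overline{g/L^{(2)}}\rangle+\sum_{i,r}\frac1{r!}\langle\xi^{(2)}_{i,r},f\rangle\overline{g^{(r)}(\zeta^{(2)}_i)}$. Objects $\check S^{(a)}_b,\check H^{(a)},\check\phi^{(a)}_b,\check C^{(a)}_b$ are those associated in the same way with $\check u^{(a)}$ ($\check C^{(a)}_1$ being defined for $z\notin\overline{\operatorname{supp}_2(\check u^{(a)})}$ and $\check C^{(a)}_2$ for $z\notin\overline{\operatorname{supp}_1(\check u^{(a)})}$). *)

(* Defs.v *)
From HB Require Import structures.
From mathcomp Require Import all_boot all_order all_algebra.
From mathcomp Require Import fraction complex.
From mathcomp Require Import all_classical all_reals all_analysis.

Set Implicit Arguments.
Unset Strict Implicit.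
Unset Printing Implicit Defensive.

Import Order.TTheory GRing.Theory Num.Theory.
Import numFieldNormedType.Exports.

Local Open Scope classical_set_scope.
Local Open Scope ring_scope.

(* The field of complex numbers, as a structure: its sort then carries the
   topology of every numClosedFieldType, which R[i] itself lacks. *)
Definition cplx (R : realType) : numClosedFieldType := R[i].

Section RationalFunctions.
Variable R : realType.
Local Notation C := (cplx R).

Definition ratfun := {fraction {poly C}}.

Definition ratC (c : C) : ratfun := tofrac c%:P.
Definition ratX : ratfun := tofrac 'X.

Definition regular_at (f : ratfun) (z : C) : Prop :=
  exists p q : {poly C}, q.[z] != 0 /\ f * tofrac q = tofrac p.

(* The value of [f] at a regular point; it is 0 at the poles of [f]. *)
Definition rval (f : ratfun) (z : C) : C :=
  xget 0 [set w | exists p q : {poly C},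
    [/\ q.[z] != 0, f * tofrac q = tofrac p & w = p.[z] / q.[z]]].

Definition poles_outside (A : set C) (f : ratfun) : Prop :=
  forall z, z != 0 -> A z -> regular_at f z.

Definition tensor (f g : ratfun) (p : C * C) : C :=
  rval f p.1 * (rval g p.2)^*.

Definition cauchy_kernel (x : C) : ratfun := (ratC x - ratX)^-1.

End RationalFunctions.

Arguments ratX {R}.

Definition Cstar2 {R : realType} : set (cplx R * cplx R) :=
  [set p | p.1 != 0 /\ p.2 != 0].

Section Support.
Variable R : realType.
Local Notation C := (cplx R).

Variables (E : Type) (val : E -> C * C -> C) (w : E -> C).

(* [w] kills every test function whose support, taken in C* x C*, is in [U]. *)
Definition vanishes_on (U : set (C * C)) : Prop :=
  forall e, closure (Cstar2 `&` [set p | val e p != 0]) `&` Cstar2 `<=` U ->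
    w e = 0.

(* C* x C* is open in C x C, so its open subsets are those of C x C that it
   contains. *)
Definition functional_support : set (C * C) :=
  Cstar2 `\` \bigcup_(U in [set U | [/\ open U, U `<=` Cstar2
                                      & vanishes_on U]]) U.

End Support.

(* Test functions form a topological vector space [bf_test], realized as
   functions on C* x C* by [bf_val]; the values of [bf_val e] off C* x C* are
   irrelevant.  The support is well defined when the functional vanishes on the
   union of the open sets on which it vanishes.  It then depends only on the
   germs of test functions along its support, so that the value 0 given to a
   rational function at its poles plays no role. *)
Record bifunctional (R : realType) := BiFunctional {
  bf_test : topologicalLmodType (cplx R) ;
  bf_val : bf_test -> cplx R * cplx R -> cplx R ;
  bf_val_linear : forall (a : cplx R) (x y : bf_test) (p : cplx R * cplx R),
    bf_val (a *: x + y) p = a * bf_val x p + bf_val y p ;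
  bf_val_inj : forall x y : bf_test,
    (forall p, Cstar2 p -> bf_val x p = bf_val y p) -> x = y ;
  bf_fun : {scalar bf_test} ;
  bf_continuous : continuous (bf_fun : bf_test -> cplx R) ;
  bf_support := functional_support bf_val bf_fun ;
  bf_support_wd : vanishes_on bf_val bf_fun (Cstar2 `\` bf_support) ;
  bf_tensor : forall f g : ratfun R,
    poles_outside (fst @` bf_support) f ->
    poles_outside (snd @` bf_support) g ->
    exists e, forall p, Cstar2 p -> bf_val e p = tensor f g p
}.

Section Functionals.
Variable R : realType.
Local Notation C := (cplx R).
Implicit Types u v : bifunctional R.

Definition supp1 u : set C := fst @` bf_support u.
Definition supp2 u : set C := snd @` bf_support u.

(* The value of [u] on the test function with the values of [phi] on C* x C*,
   which is unique if it exists. *)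
Definition bf_pair u (phi : C * C -> C) : C :=
  bf_fun u (xget 0 [set e | forall p, Cstar2 p -> bf_val e p = phi p]).

Definition bf_form u (f g : ratfun R) : C := bf_pair u (tensor f g).

Definition conj_set (A : set C) : set C := [set z^* | z in A].

End Functionals.

Section SemiInfinite.
Variable R : realType.
Local Notation C := (cplx R).

(* Row and column vectors are both of type nat -> C. *)
Definition smx := nat -> nat -> C.

(* \sum_(k \in setT) is a sum with finite support (and 0 otherwise); all the
   products below have finitely many nonzero terms in each entry. *)
Definition smul (A B : smx) : smx :=
  fun i j => \sum_(k \in [set: nat]) (A i k * B k j).
Definition sone : smx := fun i j => (i == j)%:R.
Definition str (A : smx) : smx := fun i j => A j i.
Definition sdag (A : smx) : smx := fun i j => (A j i)^*.
Definition sdiag (h : nat -> C) : smx := fun i j => (i == j)%:R * h i.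
Definition spow (A : smx) (n : nat) : smx := iter n (smul A) sone.

(* The two-sided inverse, unique for lower unitriangular matrices. *)
Definition sinv (A : smx) : smx :=
  xget A [set B | smul A B = sone /\ smul B A = sone].

Definition smulc (A : smx) (c : nat -> C) : nat -> C :=
  fun i => \sum_(k \in [set: nat]) (A i k * c k).
Definition smulr (r : nat -> C) (A : smx) : nat -> C :=
  fun j => \sum_(k \in [set: nat]) (r k * A k j).
Definition vdag (c : nat -> C) : nat -> C := fun k => (c k)^*.

Definition lower_unitriangular (A : smx) : Prop :=
  (forall i j, (i < j)%N -> A i j = 0) /\ (forall i, A i i = 1).

Definition quasidefinite (G : smx) : Prop :=
  forall k, \det (\matrix_(i < k, j < k) G i j) != 0.

(* G = S1^-1 H (S2^-1)^dagger with H = diag(h). *)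
Definition gauss_borel (G S1 : smx) (h : nat -> C) (S2 : smx) : Prop :=
  [/\ lower_unitriangular S1, lower_unitriangular S2, forall i, h i != 0
    & G = smul (smul (sinv S1) (sdiag h)) (sdag (sinv S2))].

Definition chi (k : nat) : ratfun R :=
  if odd k then ratX ^- (k.+1)./2 else ratX ^+ k./2.

Definition Upsilon : smx := fun i j =>
  ([|| ~~ odd i && (j == i.+2), (i == 1) && (j == 0)
     | odd j && (i == j.+2)]%N)%:R.

(* Integer powers, with Upsilon^-1 = Upsilon^T. *)
Definition Upsilonz (j : int) : smx :=
  match j with
  | Posz n => spow Upsilon n
  | Negz n => spow (str Upsilon) n.+1
  end.

End SemiInfinite.

(* L(z) = \sum_(- lneg <= j <= lpos) L_j z^j; only these coefficients count. *)
Record laurent (R : realType) := Laurent {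
  lpos : nat ;
  lneg : nat ;
  lcoef : int -> cplx R ;
  lcoef_pos : lcoef lpos%:Z != 0 ;
  lcoef_neg : lcoef (- lneg%:Z) != 0
}.

Section LaurentPolynomials.
Variable R : realType.
Local Notation C := (cplx R).
Variable L : laurent R.

Definition lexp (k : nat) : int := k%:Z - (lneg L)%:Z.

Definition leval (z : C) : C :=
  \sum_(k < (lpos L + lneg L).+1) lcoef L (lexp k) * z ^ lexp k.

Definition lrat : ratfun R :=
  \sum_(k < (lpos L + lneg L).+1) ratC (lcoef L (lexp k)) * ratX ^ lexp k.

Definition lmx : smx R := fun i j =>
  \sum_(k < (lpos L + lneg L).+1) lcoef L (lexp k) * Upsilonz R (lexp k) i j.

Definition lzeros : set C := [set z | z != 0 /\ leval z = 0].

Definition levalbar (z : C) : C := (leval z^*)^*.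

(* y |-> (L(x) - L(y)) / (x - y), a Laurent polynomial in y when x != 0 *)
Definition ldelta (x : C) : ratfun R :=
  (ratC (leval x) - lrat) / (ratC x - ratX).

End LaurentPolynomials.

Section Biorthogonal.
Variable R : realType.
Local Notation C := (cplx R).
Implicit Types (u v : bifunctional R) (S : smx R).

Definition gram u : smx R := fun k l => bf_form u (chi R k) (chi R l).

Definition phi S (i : nat) : ratfun R :=
  \sum_(k \in [set: nat]) (ratC (S i k) * chi R k).

(* Column vectors C_1(z) and C_2(z); the row vector C_2(z)^dagger has entries
   < 1/(conj z - z1), phi_{2,k}(z2) >_u. *)
Definition cauchy1 u S1 (z : C) : nat -> C :=
  fun k => bf_form u (phi S1 k) (cauchy_kernel z^*).
Definition cauchy2 u S2 (z : C) : nat -> C :=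
  vdag (fun k => bf_form u (cauchy_kernel z^*) (phi S2 k)).

(* L(z1) v = u, tested on the pairs (f, g) admissible for both u and v: were f
   allowed a pole at a zero of L in supp1 v, the masses of v there would break
   the identity. *)
Definition geronimus1 (L : laurent R) u v : Prop :=
  forall f g : ratfun R,
    poles_outside (supp1 u `|` supp1 v) f ->
    poles_outside (supp2 u `|` supp2 v) g ->
    bf_form v (lrat L * f) g = bf_form u f g.

Definition geronimus2 (L : laurent R) u v : Prop :=
  forall f g : ratfun R,
    poles_outside (supp1 u `|` supp1 v) f ->
    poles_outside (supp2 u `|` supp2 v) g ->
    bf_form v f (lrat L * g) = bf_form u f g.

End Biorthogonal.

(* Main.v *)
Require Import Defs.
From HB Require Import structures.
From mathcomp Require Import all_boot all_order all_algebra.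
From mathcomp Require Import fraction complex.
From mathcomp Require Import all_classical all_reals all_analysis.
From mathcomp Require Import ring zify.
Import Order.TTheory GRing.Theory Num.Theory.
Import numFieldNormedType.Exports.
Local Open Scope classical_set_scope.
Local Open Scope ring_scope.


(** All four identities come from one mechanism.  Fix one slot of a
    sesquilinear form as the Cauchy kernel.  The other slot is then a linear,
    or conjugate-linear, function [F] of a rational function, so that a matrix
    with finite rows can be moved from the values [F (phi S k)] into the
    argument of [F] ([semilinear_connection]).  A connection matrix has the
    form [M S^-1] with [S] lower unitriangular, and [phi S = S chi]; inside
    [F] the product therefore collapses to [M chi] ([lincomb_phi]).

    If [M] is a factor of the Geronimus side, [M chi] is the transformed
    family [phi M], and it remains to pass from [u] to the transformed
    functional: the pairing of [u] with the kernel [K] is that of the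
    transformed functional with [L K].  Since [(L(x) - L) K] is the difference
    quotient of [L] at [x], replacing [L K] by [L(x) K] costs exactly the
    right-hand sides of the first two identities ([semilinear_ldelta]).
    If [M = S L(Upsilon)], then [M chi = L S chi] because [Upsilon] acts on
    [chi] as multiplication by the variable ([lmx_chi]), and the factor [L]
    is absorbed by the Geronimus relation; this gives the last two identities.

    Two points need care.  Infinite matrices do not form a ring, so
    associativity is used only when the rows on the left are finite, which
    requires the inverse of a unitriangular matrix to be unitriangular
    ([sinvP]).  And a rational function is evaluated to 0 at its poles, so that
    evaluation is not additive there: a form is additive because a functional
    ignores what a test function does on a closed set disjoint from its
    support ([bf_fun_local]), in particular near the poles of admissible
    functions. *)

Set Implicit Arguments.
Unset Strict Implicit.
Unset Printing Implicit Defensive.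


(** * Semi-infinite matrices with finite rows *)

Lemma fsum_ord (V : nmodType) (F : nat -> V) n :
  (forall k, (n <= k)%N -> F k = 0) ->
  \sum_(k \in [set: nat]) F k = \sum_(k < n) F k.
Proof.
move=> F0; rewrite fsbig_ord; apply/esym/fsbig_widen => // k [_ /negP].
by rewrite -leqNgt; exact: F0.
Qed.

Section SemiInfiniteAlgebra.
Variable R : realType.
Local Notation C := (cplx R).
Implicit Types (A B M S : smx R) (a : nat -> C).

Definition finite_row a := exists n, forall k, (n <= k)%N -> a k = 0.
Definition row_finite A := forall i, finite_row (A i).

Section LinearCombinations.
Variables (V : nzRingType) (c : {rmorphism C -> V}).

(** With [c] the identity this is an entry of a matrix product; with [c] the
    constant rational functions it is an entry of [S chi].  One associativity
    lemma thus serves both. *)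
Definition lincomb a (v : nat -> V) : V :=
  \sum_(k \in [set: nat]) (c (a k) * v k).

Lemma lincomb_ord a (v : nat -> V) n :
  (forall k, (n <= k)%N -> a k = 0) ->
  lincomb a v = \sum_(k < n) c (a k) * v k.
Proof. by move=> a0; apply: fsum_ord => k /a0 ->; rewrite rmorph0 mul0r. Qed.

Lemma lincomb_delta t (v : nat -> V) : lincomb (fun k => (k == t)%:R) v = v t.
Proof.
rewrite (@lincomb_ord _ _ t.+1) => [|k]; last by case: ltngtP.
rewrite (bigD1 ord_max) //= eqxx rmorph1 mul1r big1 ?addr0 // => k.
by rewrite -val_eqE /= => /negPf ->; rewrite rmorph0 mul0r.
Qed.

End LinearCombinations.

(** Finitely many finite rows have a common length, which turns the nested
    sums below into finite double sums. *)
Lemma row_finite_common B : row_finite B -> forall n, exists m, forall j k,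
  (j < n)%N -> (m <= k)%N -> B j k = 0.
Proof.
move=> Bf; elim=> [|n [m IH]]; first by exists 0%N.
have [p Hp] := Bf n; exists (maxn m p) => j k.
rewrite ltnS leq_eqVlt geq_max => /orP[/eqP ->|jn] /andP[mk pk].
  exact: Hp.
exact: IH.
Qed.

Lemma smulE A B i j n : (forall k, (n <= k)%N -> A i k = 0) ->
  smul A B i j = \sum_(k < n) A i k * B k j.
Proof. by move=> A0; apply: fsum_ord => k /A0 ->; rewrite mul0r. Qed.

Lemma row_finite_smul A B : row_finite A -> row_finite B ->
  row_finite (smul A B).
Proof.
move=> Af Bf i; have [n An] := Af i.
have [m Bm] := row_finite_common Bf n; exists m => k mk.
by rewrite (smulE _ _ An) big1 // => j _; rewrite Bm ?mulr0.
Qed.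

Lemma lincomb_smul (V : nzRingType) (c : {rmorphism C -> V}) A B
    (v : nat -> V) i : row_finite A -> row_finite B ->
  lincomb c (smul A B i) v = lincomb c (A i) (fun j => lincomb c (B j) v).
Proof.
move=> Af Bf; have [n An] := Af i.
have [m Bm] := row_finite_common Bf n.
have ABE k := smulE B k An.
rewrite (@lincomb_ord _ _ _ _ m) => [|k mk]; last first.
  by rewrite ABE big1 // => j _; rewrite Bm ?mulr0.
rewrite (lincomb_ord _ _ An).
transitivity (\sum_(k < m) \sum_(j < n) c (A i j) * (c (B j k) * v k)).
  apply: eq_bigr => k _; rewrite ABE rmorph_sum mulr_suml.
  by apply: eq_bigr => j _; rewrite rmorphM mulrA.
rewrite exchange_big; apply: eq_bigr => j _ /=.
by rewrite (@lincomb_ord _ _ _ _ m) ?mulr_sumr // => k; exact: Bm.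
Qed.

Lemma smulA A B M : row_finite A -> row_finite B ->
  smul (smul A B) M = smul A (smul B M).
Proof.
move=> Af Bf; apply/funext => i; apply/funext => j.
exact: (lincomb_smul idfun (M^~ j) i Af Bf).
Qed.

Lemma soneE i : sone R i = (fun k => (k == i)%:R).
Proof. by apply/funext => k; rewrite /sone eq_sym. Qed.

Lemma smul1l M : smul (sone R) M = M.
Proof.
apply/funext => i; apply/funext => j.
by rewrite /smul soneE; exact: (lincomb_delta idfun i (M^~ j)).
Qed.

Lemma smul1r A : row_finite A -> smul A (sone R) = A.
Proof.
move=> Af; apply/funext => i; apply/funext => j; have [n An] := Af i.
rewrite (@smulE _ _ _ _ (maxn n j.+1)); last first.
  by move=> k; rewrite geq_max => /andP[/An].
have jlt : (j < maxn n j.+1)%N by rewrite leq_max ltnSn orbT.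
rewrite (bigD1 (Ordinal jlt)) //= /sone eqxx mulr1 big1 ?addr0 // => k.
by rewrite -val_eqE /= => /negPf ->; rewrite mulr0.
Qed.

Lemma row_finite_unitriangular S : lower_unitriangular S -> row_finite S.
Proof. by case=> S0 _ i; exists i.+1 => k; exact: S0. Qed.

(** Isolating the diagonal term gives the recursion of forward substitution,
    both for constructing an inverse and for showing that it is triangular. *)
Lemma smul_unitriangularE S B i j : lower_unitriangular S ->
  smul S B i j = \sum_(k < i) S i k * B k j + B i j.
Proof.
move=> [S0 S1]; rewrite (@smulE _ _ _ _ i.+1); last by move=> k /S0.
by rewrite big_ord_recr /= S1 mul1r.
Qed.

(** The first [n] rows of the inverse of [S], by forward substitution. *)
Fixpoint subst_rows S n : smx R :=
  if n is m.+1 then fun i j =>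
    if i == m then sone R m j - \sum_(k < m) S m k * subst_rows S m k j
    else subst_rows S m i j
  else fun _ _ => 0.

Lemma right_inverse S : lower_unitriangular S -> exists B, smul S B = sone R.
Proof.
move=> SU; pose B : smx R := fun i => subst_rows S i.+1 i.
have BE n k j : (k < n)%N -> subst_rows S n k j = B k j.
  elim: n => // n IH; rewrite ltnS leq_eqVlt => /orP[/eqP -> //|kn].
  by rewrite /= (ltn_eqF kn) IH.
exists B; apply/funext => i; apply/funext => j.
have rec : B i j = sone R i j - \sum_(k < i) S i k * B k j.
  rewrite {1}/B /= eqxx; congr (_ - _); apply: eq_bigr => k _.
  by rewrite BE.
by rewrite smul_unitriangularE // rec addrC subrK.
Qed.

(** Forward substitution leaves no choice: the right inverse may be any
    matrix, without finiteness of its rows. *)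
Lemma unitriangular_right_inverse S B : lower_unitriangular S ->
  smul S B = sone R -> lower_unitriangular B.
Proof.
move=> SU SB.
have rec i j : B i j = sone R i j - \sum_(k < i) S i k * B k j.
  by rewrite -SB smul_unitriangularE // addrAC subrr add0r.
have B0 i : forall j, (i < j)%N -> B i j = 0.
  elim/ltn_ind: i => i IH j ij; rewrite rec /sone (ltn_eqF ij) big1 ?subr0 //.
  by move=> k _; rewrite IH ?mulr0 // (ltn_trans _ ij).
split=> // i; rewrite rec /sone eqxx big1 ?subr0 // => k _.
by rewrite B0 ?mulr0.
Qed.

(** A right inverse [B] of [S] is unitriangular, hence has a right inverse
    [D] itself; then [S = S (B D) = (S B) D = D], so [B] is two-sided.  This
    makes the set from which [sinv] chooses nonempty. *)
Lemma sinvP S : lower_unitriangular S ->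
  row_finite (sinv S) /\ smul (sinv S) S = sone R.
Proof.
move=> SU; have [B SB] := right_inverse SU.
have BU := unitriangular_right_inverse SU SB.
have [Sf Bf] := (row_finite_unitriangular SU, row_finite_unitriangular BU).
have [D BD] := right_inverse BU.
have SD : S = D by rewrite -(smul1r Sf) -BD -smulA // SB smul1l.
have := @xgetI _ S [set T | smul S T = sone R /\ smul T S = sone R] B.
rewrite -/(sinv S) /= => /(_ _)[|SsS sSS].
  by split=> //; rewrite {1}SD.
split=> //; apply: row_finite_unitriangular.
exact: unitriangular_right_inverse SsS.
Qed.

End SemiInfiniteAlgebra.


(** * The action of Upsilon on the CMV sequence *)

Section SpectralAction.
Variable R : realType.
Local Notation C := (cplx R).

HB.instance Definition _ := GRing.RMorphism.copy (@ratC R)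
  (@tofrac {poly C} \o @polyC C).

Lemma ratX_neq0 : (ratX : ratfun R) != 0.
Proof. by rewrite /ratX tofrac_eq0 polyX_eq0. Qed.

(** Every row of [Upsilon] and of its transpose has a single nonzero entry,
    in the column of the CMV index of [z chi_i] and of [z^-1 chi_i]. *)
Definition mulX_index i :=
  if odd i then (if i == 1 then 0 else i.-2)%N else i.+2.
Definition mulXV_index i :=
  if odd i then i.+2 else (if i == 0 then 1 else i.-2)%N.

Lemma UpsilonE i : Upsilon R i = (fun j => (j == mulX_index i)%:R).
Proof.
apply/funext => j; congr (nat_of_bool _)%:R; rewrite /mulX_index.
by case: (eqVneq i 1%N) => [->|?]; case oi: (odd i) => /=; lia.
Qed.

Lemma str_UpsilonE i : str (Upsilon R) i = (fun j => (j == mulXV_index i)%:R).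
Proof.
apply/funext => j; congr (nat_of_bool _)%:R; rewrite /mulXV_index.
by case: (eqVneq i 0%N) => [->|?]; case oi: (odd i) => /=; lia.
Qed.

Lemma chi_mulX i : chi R (mulX_index i) = ratX * chi R i.
Proof.
have X0 := ratX_neq0; rewrite /mulX_index; case oi: (odd i); last first.
  by rewrite /chi /= negbK oi -exprS.
case: eqVneq => [->|i1]; first by rewrite /chi /= expr0 expr1 divff.
case: i oi i1 => [|[|i]] //=; rewrite negbK => oi _.
by rewrite /chi /= negbK oi [in RHS]exprS invfM mulrA divff // mul1r.
Qed.

Lemma chi_mulXV i : chi R (mulXV_index i) = ratX^-1 * chi R i.
Proof.
have X0 := ratX_neq0; rewrite /mulXV_index; case oi: (odd i).
  by rewrite /chi /= negbK oi /= exprS invfM.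
case: eqVneq => [->|i0]; first by rewrite /chi /= expr0 mulr1 expr1.
case: i oi i0 => [|[|i]] //=; rewrite negbK => oi _.
by rewrite /chi /= negbK oi [in RHS]exprS mulrA mulVf // mul1r.
Qed.

Lemma row_finite_delta (A : smx R) (t : nat -> nat) :
  (forall i, A i = (fun k => (k == t i)%:R)) -> row_finite A.
Proof. by move=> AE i; exists (t i).+1 => k; rewrite AE; case: ltngtP. Qed.

Lemma row_finite_spow (A : smx R) n : row_finite A -> row_finite (spow A n).
Proof.
move=> Af; elim: n => [|n IH]; last exact: row_finite_smul.
by apply: (@row_finite_delta _ id) => i; rewrite -soneE.
Qed.

(** Powers of an operator keep its eigenvector [chi], because multiplication
    by [x] commutes with the scalar combinations. *)
Lemma lincomb_spow (A : smx R) (x : ratfun R) n i : row_finite A ->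
  (forall i, lincomb (@ratC R) (A i) (chi R) = x * chi R i) ->
  lincomb (@ratC R) (spow A n i) (chi R) = x ^+ n * chi R i.
Proof.
move=> Af AE; elim: n i => [|n IH] i.
  by rewrite /spow /= soneE lincomb_delta mul1r.
have [m Am] := Af i.
rewrite [spow A _]/(smul A (spow A n)) lincomb_smul //; last first.
  exact: row_finite_spow.
rewrite exprSr -mulrA -AE !(lincomb_ord _ _ Am) mulr_sumr.
by apply: eq_bigr => k _; rewrite IH mulrCA.
Qed.

Lemma Upsilonz_chi j i : row_finite (Upsilonz R j) /\
  lincomb (@ratC R) (Upsilonz R j i) (chi R) = ratX ^ j * chi R i.
Proof.
have Uf := row_finite_delta UpsilonE; have Vf := row_finite_delta str_UpsilonE.
case: j => n; split; try exact: row_finite_spow.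
  by apply: lincomb_spow => // k; rewrite UpsilonE lincomb_delta chi_mulX.
rewrite NegzE -exprnN -exprVn.
by apply: lincomb_spow => // k; rewrite str_UpsilonE lincomb_delta chi_mulXV.
Qed.

Lemma row_finite_lmx (L : laurent R) : row_finite (lmx L).
Proof.
move=> i; rewrite /lmx; elim: (lpos L + lneg L).+1 => [|n [m IH]].
  by exists 0%N => k _; rewrite big_ord0.
have [p Hp] := (Upsilonz_chi (lexp L n) i).1 i; exists (maxn m p) => k.
rewrite geq_max => /andP[mk pk].
by rewrite big_ord_recr /= IH // Hp // mulr0 addr0.
Qed.

(** The spectral identity [L(Upsilon) chi = L chi]. *)
Lemma lmx_chi (L : laurent R) i :
  lincomb (@ratC R) (lmx L i) (chi R) = lrat L * chi R i.
Proof.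
rewrite /lrat mulr_suml; have [m Lm] := row_finite_lmx L i.
pose E k := Upsilonz R (lexp L k) i.
have [p Hp] : exists p, forall k j, (k < (lpos L + lneg L).+1)%N ->
    (p <= j)%N -> E k j = 0.
  apply: (@row_finite_common R E) => k.
  exact: (Upsilonz_chi (lexp L k) i).1.
rewrite (@lincomb_ord _ _ _ _ _ (maxn m p)); last first.
  by move=> k; rewrite geq_max => /andP[/Lm].
transitivity (\sum_(j < maxn m p) \sum_(k < (lpos L + lneg L).+1)
    ratC (lcoef L (lexp L k)) * (ratC (E k j) * chi R j)).
  apply: eq_bigr => j _; rewrite rmorph_sum mulr_suml.
  by apply: eq_bigr => k _; rewrite rmorphM mulrA.
rewrite exchange_big; apply: eq_bigr => k _ /=.
rewrite -mulr_sumr -mulrA -(Upsilonz_chi (lexp L k) i).2; congr (_ * _).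
rewrite (@lincomb_ord _ _ _ _ _ (maxn m p)) // => j.
by rewrite geq_max => /andP[_ pj]; apply: Hp.
Qed.

Lemma lincomb_mull (x : ratfun R) (a : nat -> C) v : finite_row a ->
  lincomb (@ratC R) a (fun k => x * v k) = x * lincomb (@ratC R) a v.
Proof.
move=> [n an]; rewrite !(lincomb_ord _ _ an) mulr_sumr.
by apply: eq_bigr => k _; rewrite mulrCA.
Qed.

(** The step [M S^-1 S chi = M chi], where associativity needs the finite rows
    of [S^-1]. *)
Lemma lincomb_phi (M S : smx R) i : row_finite M -> lower_unitriangular S ->
  lincomb (@ratC R) (smul M (sinv S) i) (phi S) =
  lincomb (@ratC R) (M i) (chi R).
Proof.
move=> Mf SU; have [Tf TS] := sinvP SU.
have Sf := row_finite_unitriangular SU.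
rewrite -(lincomb_smul _ _ _ (row_finite_smul Mf Tf) Sf).
by rewrite smulA // TS smul1r.
Qed.

Lemma lincomb_phi_lmx (L : laurent R) (S : smx R) i : row_finite S ->
  lincomb (@ratC R) (smul S (lmx L) i) (chi R) = lrat L * phi S i.
Proof.
move=> Sf; rewrite lincomb_smul //; last exact: row_finite_lmx.
rewrite -(lincomb_mull _ _ (Sf i)); congr (lincomb _ _ _).
by apply/funext => k; exact: lmx_chi.
Qed.

End SpectralAction.


(** * Regular points of rational functions *)

Lemma horner_continuous (K : numFieldType) (p : {poly K}) :
  continuous (horner p : K -> K).
Proof.
elim/poly_ind: p => [|p c IH] z.
  rewrite (_ : horner 0 = cst 0); first exact: cst_continuous.
  by apply/funext => y; rewrite horner0.
rewrite (_ : horner _ = (fun y => p.[y] * y + c)); last first.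
  by apply/funext => y; rewrite !hornerE.
apply: (@continuousD _ K K (fun y => p.[y] * y) (cst c)).
  by apply: (@continuousM _ K (horner p) id); [exact: IH | exact: cvg_id].
exact: cst_continuous.
Qed.

Section Regularity.
Variable R : realType.
Local Notation C := (cplx R).
Implicit Types (f g : ratfun R) (z x : C) (L : laurent R).

Lemma regularD f g z : regular_at f z -> regular_at g z ->
  regular_at (f + g) z.
Proof.
move=> [p [q [q0 fE]]] [p' [q' [q'0 gE]]].
exists (p * q' + p' * q), (q * q'); rewrite hornerM mulf_neq0 //; split=> //.
rewrite rmorphD !rmorphM mulrDl mulrA fE [g * _]mulrCA gE.
by rewrite [_ * tofrac p']mulrC.
Qed.

Lemma regularM f g z : regular_at f z -> regular_at g z ->
  regular_at (f * g) z.
Proof.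
move=> [p [q [q0 fE]]] [p' [q' [q'0 gE]]].
exists (p * p'), (q * q'); rewrite hornerM mulf_neq0 //; split=> //.
by rewrite !rmorphM mulrACA fE gE.
Qed.

Lemma regular_poly (p : {poly C}) z : regular_at (tofrac p) z.
Proof. by exists p, 1; rewrite hornerC oner_neq0 rmorph1 mulr1. Qed.

Lemma regularV (q : {poly C}) z : q.[z] != 0 -> regular_at (tofrac q)^-1 z.
Proof.
move=> q0; exists 1, q; split=> //; rewrite mulVf ?rmorph1 // tofrac_eq0.
by apply: contraNneq q0 => ->; rewrite horner0.
Qed.

Lemma regular_cauchy x z : z != x -> regular_at (cauchy_kernel x) z.
Proof.
move=> zx; rewrite /cauchy_kernel /ratC /ratX -rmorphB; apply: regularV.
by rewrite !hornerE subr_eq0 eq_sym.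
Qed.

Lemma regularX f n z : regular_at f z -> regular_at (f ^+ n) z.
Proof.
move=> fz; elim: n => [|n IH]; last by rewrite exprS; exact: regularM.
by rewrite expr0 -[1](rmorph1 (@tofrac {poly C})); exact: regular_poly.
Qed.

Lemma regular_ratXV z : z != 0 -> regular_at (ratX^-1) z.
Proof. by move=> z0; apply: regularV; rewrite hornerX. Qed.

Lemma regular_sum (I : Type) (r : seq I) (F : I -> ratfun R) z :
  (forall i, regular_at (F i) z) -> regular_at (\sum_(i <- r) F i) z.
Proof.
move=> Fz; elim/big_ind: _ => // [|f g]; last exact: regularD.
by rewrite -(rmorph0 (@tofrac {poly C})); exact: regular_poly.
Qed.

Lemma regular_chi k z : z != 0 -> regular_at (chi R k) z.
Proof.
move=> z0; rewrite /chi; case: ifP => _; last exact/regularX/regular_poly.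
by rewrite -exprVn; exact/regularX/regular_ratXV.
Qed.

Lemma regular_lrat L z : z != 0 -> regular_at (lrat L) z.
Proof.
move=> z0; apply: regular_sum => k; apply: regularM; first exact: regular_poly.
case: (lexp L k) => n; first exact/regularX/regular_poly.
by rewrite NegzE -exprnN -exprVn; exact/regularX/regular_ratXV.
Qed.

Lemma regular_phi (S : smx R) k z : row_finite S -> z != 0 ->
  regular_at (phi S k) z.
Proof.
move=> Sf z0; have [n Sn] := Sf k.
rewrite [phi S k](lincomb_ord (@ratC R) _ Sn); apply: regular_sum => i.
by apply: regularM; [exact: regular_poly | exact: regular_chi].
Qed.

Lemma regular_ldelta L x z : z != 0 -> z != x -> regular_at (ldelta L x) z.
Proof.
move=> z0 zx; apply: regularM; last exact: regular_cauchy.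
apply: regularD; first exact: regular_poly.
rewrite -mulN1r -[-1](rmorphN1 (@tofrac {poly C})).
by apply: regularM; [exact: regular_poly | exact: regular_lrat].
Qed.

(** Two fractions that represent [f] have equal cross products, so they agree
    wherever both denominators are nonzero. *)
Lemma rvalE f z (p q : {poly C}) : q.[z] != 0 ->
  f * tofrac q = tofrac p -> rval f z = p.[z] / q.[z].
Proof.
move=> q0 fE; apply: xget_unique; first by exists p, q.
move=> w [p' [q' [q'0 fE' ->]]]; apply/eqP.
rewrite eqr_div // -!hornerM; apply/eqP; congr horner.
apply/eqP; rewrite -tofrac_eq; apply/eqP.
by rewrite !rmorphM /= -fE -fE' mulrAC.
Qed.

Lemma rval_linear (a : C) f g z : regular_at f z -> regular_at g z ->
  rval (ratC a * f + g) z = a * rval f z + rval g z.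
Proof.
move=> [p [q [q0 fE]]] [p' [q' [q'0 gE]]].
rewrite (rvalE q0 fE) (rvalE q'0 gE).
rewrite (@rvalE _ z (a%:P * p * q' + p' * q) (q * q')).
- by rewrite !(hornerD, hornerM, hornerC); field; rewrite q0 q'0.
- by rewrite hornerM mulf_neq0.
rewrite rmorphD !rmorphM mulrDl /ratC -!mulrA [f * _]mulrA fE.
by rewrite [g * _]mulrCA gE [_ * tofrac p']mulrC !mulrA.
Qed.

(** A representation of [f] regular at one point is regular off the zeros of
    its denominator. *)
Lemma open_regular f : open [set z | regular_at f z].
Proof.
have -> : [set z | regular_at f z] =
    \bigcup_(q in [set q | exists p, f * tofrac q = tofrac p])
      (horner q @^-1` [set~ 0]).
  apply/seteqP; split=> z /= [].
    by move=> p [q [/eqP q0 fE]]; exists q => //; exists p.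
  by move=> q [p fE] /eqP q0; exists p, q.
apply: bigcup_open => q _; apply: open_comp.
  by move=> z _; exact: horner_continuous.
by rewrite openC; apply: accessible_closed_set1;
  exact/hausdorff_accessible/norm_hausdorff.
Qed.

End Regularity.

(** * Semilinear functions of a rational function *)

Section Semilinear.
Variables (R : realType) (A : set (cplx R)).
Local Notation C := (cplx R).
Implicit Types (f g : ratfun R).

Lemma poles_outside_linear (a : C) f g :
  poles_outside A f -> poles_outside A g ->
  poles_outside A (ratC a * f + g).
Proof.
move=> fA gA z z0 Az; apply: regularD; last exact: gA.
by apply: regularM; [exact: regular_poly | exact: fA].
Qed.

Variable s : {rmorphism C -> C}.

(** The two slots of a form are linear and conjugate-linear; [s] is the
    identity or the conjugation, so that each argument is made once. *)
Definition semilinear_on (F : ratfun R -> C) := forall c f g,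
  poles_outside A f -> poles_outside A g ->
  F (ratC c * f + g) = s c * F f + F g.

Variable F : ratfun R -> C.
Hypothesis Fl : semilinear_on F.

Lemma poles_outside0 : poles_outside A (0 : ratfun R).
Proof.
by rewrite -(rmorph0 (@tofrac {poly C})) => z _ _; exact: regular_poly.
Qed.

Lemma semilinear0 : F 0 = 0.
Proof.
have := Fl (-1) poles_outside0 poles_outside0.
by rewrite mulr0 addr0 rmorphN1 mulN1r addNr.
Qed.

Lemma semilinear_lincomb (a : nat -> C) v : finite_row a ->
  (forall k, poles_outside A (v k)) ->
  \sum_(k \in [set: nat]) (s (a k) * F (v k)) = F (lincomb (@ratC R) a v).
Proof.
move=> [n an] vA.
rewrite (lincomb_ord _ _ an) -[LHS]/(lincomb s a (fun k => F (v k))).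
rewrite (lincomb_ord _ _ an) {an}.
suff [] : poles_outside A (\sum_(k < n) ratC (a k) * v k) /\
  \sum_(k < n) s (a k) * F (v k) = F (\sum_(k < n) ratC (a k) * v k) by [].
elim: n => [|n [IHA IH]].
  by rewrite !big_ord0 semilinear0; split=> //; exact: poles_outside0.
rewrite !big_ord_recr /= [\sum_(k < n) ratC (a k) * v k + _]addrC.
by split; [exact: poles_outside_linear | rewrite Fl // -IH addrC].
Qed.

(** The connection formula [M S^-1 F(phi) = F(M chi)] that drives all four
    identities. *)
Lemma semilinear_connection (M S : smx R) i : row_finite M ->
  lower_unitriangular S ->
  \sum_(k \in [set: nat]) (s (smul M (sinv S) i k) * F (phi S k)) =
  F (lincomb (@ratC R) (M i) (chi R)).
Proof.
move=> Mf SU; rewrite semilinear_lincomb; first by rewrite lincomb_phi.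
  by apply: row_finite_smul => //; have [] := sinvP SU.
by move=> k z z0 _; exact/regular_phi/z0/row_finite_unitriangular.
Qed.

(** [(L(x) - L) K] is the difference quotient [ldelta L x] when [K] is the
    Cauchy kernel at [x]; this is the only source of the inhomogeneous terms.
    The three functions are regular on [A] as soon as [x] avoids it. *)
Lemma semilinear_ldelta (L : laurent R) x : ~ A x ->
  F (lrat L * cauchy_kernel x) - s (leval L x) * F (cauchy_kernel x) =
  - F (ldelta L x).
Proof.
move=> Ax.
have neqx z : A z -> z != x by move=> Az; apply: contra_notN Ax => /eqP <-.
have KA : poles_outside A (cauchy_kernel x).
  by move=> z _ Az; exact/regular_cauchy/neqx.
have dA : poles_outside A (ldelta L x).
  by move=> z z0 Az; apply: regular_ldelta => //; exact: neqx.
have dA' := poles_outside_linear (-1) dA poles_outside0.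
have -> : lrat L * cauchy_kernel x =
    ratC (leval L x) * cauchy_kernel x + (ratC (-1) * ldelta L x + 0).
  (* The summand 0 gives the right-hand side the shape c * f + g twice. *)
  rewrite /ldelta -/(cauchy_kernel x) rmorphN1 mulN1r addr0 mulrBl opprB.
  by rewrite addrC subrK.
rewrite Fl // Fl //; last exact: poles_outside0.
by rewrite semilinear0 rmorphN1 mulN1r addr0 addrC addrA addNr add0r.
Qed.

End Semilinear.

(** * Sesquilinearity of the form of a functional *)

Section Pairing.
Variables (R : realType) (u : bifunctional R).
Local Notation C := (cplx R).
Implicit Types (f g : ratfun R).

Lemma supp1_neq0 z : supp1 u z -> z != 0.
Proof. by move=> [p [[p1 _] _] <-]. Qed.

Lemma supp2_neq0 z : supp2 u z -> z != 0.
Proof. by move=> [p [[_ p2] _] <-]. Qed.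

Lemma bf_pairE (t : C * C -> C) e :
  (forall p, Cstar2 p -> bf_val e p = t p) -> bf_pair u t = bf_fun u e.
Proof.
move=> et; congr (bf_fun u _); apply: xget_unique => // e' e't.
by apply: bf_val_inj => p p0; rewrite et // e't.
Qed.

(** If [e] vanishes off the closed set [D], the closure of its nonzero set
    stays in [D], hence off the support. *)
Lemma bf_fun_local (D : set (C * C)) (e : bf_test u) : closed D ->
  D `&` bf_support u `<=` set0 ->
  (forall p, Cstar2 p -> ~ D p -> bf_val e p = 0) -> bf_fun u e = 0.
Proof.
move=> Dc Du e0; apply: bf_support_wd => p [pe p0]; split=> // pu.
apply: (Du p); split=> //; rewrite (closure_id D).1 //.
apply: closureS pe => q [q0 /= /eqP qe].
by apply: contrapT => /(e0 q q0).
Qed.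

(** Linearity for functions that are combined pointwise only off [D], which
    will be the set where a factor of a tensor product has a pole. *)
Lemma bf_pair_linear (D : set (C * C)) (a : C) t1 t2 t3 e1 e2 e3 :
  closed D -> D `&` bf_support u `<=` set0 ->
  (forall p, Cstar2 p -> @bf_val _ u e1 p = t1 p) ->
  (forall p, Cstar2 p -> @bf_val _ u e2 p = t2 p) ->
  (forall p, Cstar2 p -> @bf_val _ u e3 p = t3 p) ->
  (forall p, ~ D p -> t3 p = a * t1 p + t2 p) ->
  bf_pair u t3 = a * bf_pair u t1 + bf_pair u t2.
Proof.
move=> Dc Du E1 E2 E3 tE; rewrite (bf_pairE E1) (bf_pairE E2) (bf_pairE E3).
have : bf_fun u (-1 *: (a *: e1 + e2) + e3) = 0.
  apply: (bf_fun_local Dc Du) => p p0 Dp.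
  by rewrite !bf_val_linear E1 // E2 // E3 // tE // mulN1r addNr.
by rewrite !linearP /= => /eqP; rewrite mulN1r addrC subr_eq0 => /eqP.
Qed.

Lemma regular_fst f : open [set p : C * C | regular_at f p.1].
Proof. by apply: open_comp (@open_regular _ f) => p _; exact: cvg_fst. Qed.

Lemma regular_snd f : open [set p : C * C | regular_at f p.2].
Proof. by apply: open_comp (@open_regular _ f) => p _; exact: cvg_snd. Qed.

Lemma bf_form_linearl g : poles_outside (supp2 u) g ->
  semilinear_on (supp1 u) idfun (bf_form u ^~ g).
Proof.
move=> gu a f1 f2 f1u f2u /=; have [e1 E1] := bf_tensor f1u gu.
have [e2 E2] := bf_tensor f2u gu.
have [e3 E3] := bf_tensor (poles_outside_linear a f1u f2u) gu.
apply: (bf_pair_linear (D := ~` ([set p | regular_at f1 p.1] `&`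
                                [set p | regular_at f2 p.1])) _ _ E1 E2 E3).
- by apply: open_closedC; apply: openI; exact: regular_fst.
- move=> p [Np mulX_index]; apply: Np.
  have u1 : supp1 u p.1 by exists p.
  by split; [apply: f1u | apply: f2u] => //; exact: supp1_neq0 u1.
by move=> p /contrapT[r1 r2]; rewrite /tensor rval_linear // mulrDl mulrA.
Qed.

Lemma bf_form_linearr f : poles_outside (supp1 u) f ->
  semilinear_on (supp2 u) Num.conj (bf_form u f).
Proof.
move=> fu a g1 g2 g1u g2u /=; have [e1 E1] := bf_tensor fu g1u.
have [e2 E2] := bf_tensor fu g2u.
have [e3 E3] := bf_tensor fu (poles_outside_linear a g1u g2u).
apply: (bf_pair_linear (D := ~` ([set p | regular_at g1 p.2] `&`
                                [set p | regular_at g2 p.2])) _ _ E1 E2 E3).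
- by apply: open_closedC; apply: openI; exact: regular_snd.
- move=> p [Np mulX_index]; apply: Np.
  have u2 : supp2 u p.2 by exists p.
  by split; [apply: g1u | apply: g2u] => //; exact: supp2_neq0 u2.
move=> p /contrapT[r1 r2].
by rewrite /tensor rval_linear // rmorphD rmorphM mulrDr mulrCA.
Qed.

End Pairing.

(** * Connection formulas for the second kind functions *)

Section Connection.
Variable R : realType.
Local Notation C := (cplx R).
Implicit Types (u v : bifunctional R) (M S : smx R).

Lemma not_conj_set (A : set C) z : ~ conj_set A z -> ~ A z^*.
Proof. by move=> nAz Az; apply: nAz; exists z^* => //; rewrite conjCK. Qed.

Lemma poles_outside_cauchy (A : set C) z : ~ conj_set A z ->
  poles_outside A (cauchy_kernel z^*).
Proof.
move=> /not_conj_set nAz w _ Aw; apply: regular_cauchy.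
by apply: contra_notN nAz => /eqP <-.
Qed.

Lemma poles_outside_phi (A : set C) S k : lower_unitriangular S ->
  poles_outside A (phi S k).
Proof. by move=> SU z z0 _; exact/regular_phi/z0/row_finite_unitriangular. Qed.

Lemma poles_outsideU (A B : set C) (f : ratfun R) :
  poles_outside A f -> poles_outside B f -> poles_outside (A `|` B) f.
Proof. by move=> fA fB z z0 [/(fA z z0)|/(fB z z0)]. Qed.

Lemma cauchy1_connection u M S z k : row_finite M -> lower_unitriangular S ->
  ~ conj_set (supp2 u) z ->
  smulc (smul M (sinv S)) (cauchy1 u S z) k =
  bf_form u (lincomb (@ratC R) (M k) (chi R)) (cauchy_kernel z^*).
Proof.
move=> Mf SU /poles_outside_cauchy Ku.
by rewrite -(semilinear_connection (bf_form_linearl Ku) k Mf SU).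
Qed.

(** The entries of [C_2^dagger] are the unconjugated pairings, and the adjoint
    connection matrix supplies the conjugate scalars of the second slot. *)
Lemma cauchy2_connection u M S z k : row_finite M -> lower_unitriangular S ->
  ~ conj_set (supp1 u) z ->
  smulr (vdag (cauchy2 u S z)) (sdag (smul M (sinv S))) k =
  bf_form u (cauchy_kernel z^*) (lincomb (@ratC R) (M k) (chi R)).
Proof.
move=> Mf SU /poles_outside_cauchy Ku.
rewrite -(semilinear_connection (bf_form_linearr Ku) k Mf SU) /smulr.
by apply: eq_fsbigr => j _; rewrite /vdag /cauchy2 /vdag conjCK mulrC.
Qed.

End Connection.

Theorem proposition18 (R : realType)
  (u v1 v2 : bifunctional R) (L1 L2 : laurent R)
  (hL1 : lzeros L1 `&` supp1 u = set0)
  (hL2 : lzeros L2 `&` supp2 u = set0)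
  (hv1 : geronimus1 L1 u v1)
  (hv2 : geronimus2 L2 u v2)
  (hG : quasidefinite (gram u))
  (hG1 : quasidefinite (gram v1))
  (hG2 : quasidefinite (gram v2))
  (S1 S2 S1v1 S2v1 S1v2 S2v2 : smx R) (h h1 h2 : nat -> cplx R)
  (hS : gauss_borel (gram u) S1 h S2)
  (hSv1 : gauss_borel (gram v1) S1v1 h1 S2v1)
  (hSv2 : gauss_borel (gram v2) S1v2 h2 S2v2) :
  let Omega1_1 := smul (smul S1 (lmx L1)) (sinv S1v1) in
  let Omega1_2 := smul S2v1 (sinv S2) in
  let Omega2_1 := smul S1v2 (sinv S1) in
  let Omega2_2 := smul (smul S2 (lmx L2)) (sinv S2v2) in
  forall z : cplx R, z != 0 ->
  [/\ ~ conj_set (supp1 u) z -> ~ conj_set (supp1 v1) z -> forall k,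
        smulr (vdag (cauchy2 u S2 z)) (sdag Omega1_2) k
          - leval L1 z^* * vdag (cauchy2 v1 S2v1 z) k
        = - bf_form v1 (ldelta L1 z^*) (phi S2v1 k),
      ~ conj_set (supp2 u) z -> ~ conj_set (supp2 v2) z -> forall k,
        smulc Omega2_1 (cauchy1 u S1 z) k
          - cauchy1 v2 S1v2 z k * levalbar L2 z
        = - bf_form v2 (phi S1v2 k) (ldelta L2 z^*),
      ~ conj_set (supp2 v1) z -> ~ conj_set (supp2 u) z -> forall k,
        smulc Omega1_1 (cauchy1 v1 S1v1 z) k = cauchy1 u S1 z k
    & ~ conj_set (supp1 v2) z -> ~ conj_set (supp1 u) z -> forall k,
        smulr (vdag (cauchy2 v2 S2v2 z)) (sdag Omega2_2) k
        = vdag (cauchy2 u S2 z) k].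
Proof.
have [[U1 U2 _ _] [V11 V12 _ _] [V21 V22 _ _]] := And3 hS hSv1 hSv2.
have [[F1 F2] [W12 W21]] := ((row_finite_unitriangular U1,
  row_finite_unitriangular U2), (row_finite_unitriangular V12,
  row_finite_unitriangular V21)).
have phiA (A : set (cplx R)) S k :
    lower_unitriangular S -> poles_outside A (phi S k).
  exact: poles_outside_phi.
have KU (A B : set (cplx R)) z : ~ conj_set A z -> ~ conj_set B z ->
    poles_outside (A `|` B) (cauchy_kernel z^*).
  by move=> /poles_outside_cauchy KA /poles_outside_cauchy KB;
    exact: poles_outsideU.
move=> Omega1_1 Omega1_2 Omega2_1 Omega2_2 z z0.
split=> zu zv k.
(* In this case and the next [M] is the triangular factor of the transformed
   functional, so [M chi] is its biorthogonal family by definition. *)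
- rewrite cauchy2_connection // -/(phi S2v1 k) -hv1; [|exact: KU|exact: phiA].
  rewrite /cauchy2 /vdag conjCK.
  have phi_v1 := phiA (supp2 v1) _ k V12.
  by rewrite -(semilinear_ldelta (bf_form_linearl phi_v1) L1 (not_conj_set zv)).
- rewrite cauchy1_connection // -/(phi S1v2 k) -hv2; [|exact: phiA|exact: KU].
  rewrite [_ * levalbar L2 z]mulrC /levalbar.
  have phi_v2 := phiA (supp1 v2) _ k V21.
  by rewrite -(semilinear_ldelta (bf_form_linearr phi_v2) L2 (not_conj_set zv)).
- rewrite cauchy1_connection //; last first.
    by apply: row_finite_smul => //; exact: row_finite_lmx.
  rewrite lincomb_phi_lmx // hv1 //; first exact: phiA.
  exact: KU.
- rewrite cauchy2_connection //; last first.
    by apply: row_finite_smul => //; exact: row_finite_lmx.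
  rewrite lincomb_phi_lmx // hv2 //; last exact: phiA.
    by rewrite /cauchy2 /vdag conjCK.
  exact: KU.
Qed.
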